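(* For every integer $N\ge1$, \[\mu\left(2,\{1\}^{N-1}\right)=\frac{2^{N+1}-1}{2^{2N}}\,\zeta(N+1).\]
   Context: For positive integers $i_k,\dots,i_1$ with $i_k\ge2$, the multiple mixed value is $\mu(i_k,i_{k-1},\dots,i_1)=\sum \frac{1}{n_k^{i_k}n_{k-1}^{i_{k-1}}\cdots n_1^{i_1}}$, the sum over positive integers $n_k>n_{k-1}>\cdots>n_1$ with $n_j\equiv j \pmod 2$ for each $j$. $\mu(2,\{1\}^{N-1})$ denotes $\mu(2,1,\dots,1)$ with $N-1$ entries equal to $1$ (so $k=N$). $\zeta$ is the Riemann zeta function. *)

(* Defs.v *)
From mathcomp Require Import all_boot all_order all_algebra.
From mathcomp Require Import all_classical all_reals all_analysis.

Set Implicit Arguments.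
Unset Strict Implicit.
Unset Printing Implicit Defensive.

Import Order.TTheory GRing.Theory Num.Theory.
Import numFieldNormedType.Exports.

Local Open Scope classical_set_scope.
Local Open Scope ring_scope.

(* Multi-indices are written in decreasing order, (n_k, ..., n_1) : position p
   of the tuple holds n_(k - p), hence the parity condition. *)
Definition mixed_index (k : nat) : set (k.-tuple nat) :=
  [set n : k.-tuple nat | [/\ sorted gtn n, all (ltn 0%N) n &
                            forall p : 'I_k, tnth n p = (k - p)%N %[mod 2]]].

(* The multiple mixed value mu(i_k, ..., i_1), for i = [:: i_k; ...; i_1].  The
   terms are nonnegative, so this is an unordered sum in \bar R, equal to +oo
   exactly when the multiple series diverges. *)
Definition mixed_value (R : realType) (i : seq nat) : \bar R :=
  (\esum_(n in @mixed_index (size i))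
     (\prod_(p < size i) ((tnth n p)%:R ^+ nth 0%N i p))^-1%:E)%E.

(* The Riemann zeta function at an integer s >= 2 (the series diverges for
   s <= 1, where the limit is a junk value). *)
Definition zeta (R : realType) (s : nat) : R :=
  limn (series (fun n : nat => (n.+1%:R ^+ s)^-1 : R)).

(* Main.v *)
(** With [u = (1 - x) / (1 + x)] the connector
      [C (n, m) = int_0^1 n x^(n-1) u^m dx = int_0^1 m u^(m-1) x^n (-du)],
    extended by [C (0, m) = C (n, 0) = 1], satisfies
      [C (n, m) - C (n+2, m) = 2 m C (n+1, m) / (n+1)],
      [C (n, m) - C (n, m+2) = 2 n C (n, m+1) / (m+1)],
    and tends to 0 in each variable.  The second relation telescopes to
    [1 / n = sum_(m odd) C (n, m) * 2 / m], which replaces one factor [1 / n_N]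
    of the multiple series.  After exchanging the sums, the first relation
    telescopes the sum over [n_N > n_(N-1)] of the opposite parity to
    [C (n_(N-1), m) / (2 m)]; repeating this removes all the [n_j] and leaves
    [sum_(m odd) 2 / m * (2 m)^-N]. *)
Require Import Defs.
From mathcomp Require Import all_boot all_order all_algebra.
From mathcomp Require Import all_classical all_reals all_analysis.
From mathcomp Require Import ring lra.

Import Order.TTheory GRing.Theory Num.Theory.
Import numFieldNormedType.Exports.

Local Open Scope ring_scope.
Local Open Scope classical_set_scope.

Local Notation I01 R := (`[0%R, 1%R] : set R).
Local Notation mu := lebesgue_measure.

(** * Calculus on the unit interval *)

Lemma continuous01_integrable (R : realType) (f : R -> R) :
    (forall x, I01 R x -> {for x, continuous f}) ->
  mu.-integrable (I01 R) (EFin \o f).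
Proof.
move=> cf; apply: continuous_compact_integrable; first exact: segment_compact.
by apply: continuous_in_subspaceT => x; rewrite inE; exact: cf.
Qed.

Lemma is_derive1_continuous (R : realType) (f : R -> R) (x df : R) :
  is_derive x 1 f df -> {for x, continuous f}.
Proof. by move=> [? _]; apply/differentiable_continuous/derivable1_diffP. Qed.

Lemma Rintegral01_FTC (R : realType) (F f : R -> R) :
    (forall x, I01 R x -> {for x, continuous f}) ->
    (forall x, I01 R x -> is_derive x 1 F (f x)) ->
  \int[mu]_(x in I01 R) f x = F 1 - F 0.
Proof.
move=> cf dF.
have cF x : I01 R x -> {for x, continuous F}.
  by move=> /dF; exact: is_derive1_continuous.
rewrite /Rintegral (@continuous_FTC2 R f F 0 1)//.
- by apply: continuous_in_subspaceT => x; rewrite inE; exact: cf.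
- split.
  + move=> x x01; have [] // : is_derive x 1 F (f x).
    by apply: dF; apply: subset_itv_oo_cc.
  + by apply: cvg_at_right_filter; apply: cF; rewrite /= in_itv/= lexx ler01.
  + by apply: cvg_at_left_filter; apply: cF; rewrite /= in_itv/= lexx ler01.
- move=> x x01; rewrite derive1E; apply: derive_val.
  by apply: dF; apply: subset_itv_oo_cc.
Qed.

(** * The Cayley substitution and its moment integrals *)

Definition cayley {R : realType} (x : R) : R := (1 - x) / (1 + x).
Definition cayley_jac {R : realType} (x : R) : R := 2 / (1 + x) ^+ 2.

Lemma itv01_neq0 (R : realType) (x : R) : I01 R x -> 1 + x != 0.
Proof. by rewrite /= in_itv/= => /andP[x0 _]; rewrite gt_eqF// ltr_pwDl. Qed.

Lemma cayley_ge0 (R : realType) (x : R) : I01 R x -> 0 <= cayley x.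
Proof.
rewrite /= in_itv/= => /andP[x0 x1].
by rewrite divr_ge0 ?subr_ge0 ?addr_ge0.
Qed.

Lemma cayley_le1 (R : realType) (x : R) : I01 R x -> cayley x <= 1.
Proof.
rewrite /= in_itv/= => /andP[x0 _].
by rewrite ler_pdivrMr ?ltr_pwDl// mul1r lerD2l ge0_cp.
Qed.

Lemma cayley_jac_ge0 (R : realType) (x : R) : 0 <= cayley_jac x.
Proof. by rewrite divr_ge0// sqr_ge0. Qed.

Lemma is_derive_cayley (R : realType) (x : R) :
  1 + x != 0 -> is_derive x 1 (@cayley R) (- cayley_jac x).
Proof.
move=> x0.
have -> : @cayley R = (fun y => (1 - y) * (1 + y)^-1) by [].
apply: is_derive_eq; rewrite /cayley_jac /GRing.scale/=.
by field.
Qed.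

Lemma is_derive_monomial (R : realType) (n m : nat) (x : R) : 1 + x != 0 ->
  is_derive x 1 (fun y => y ^+ n * cayley y ^+ m)
    (n%:R * (x ^+ n.-1 * cayley x ^+ m)
     - m%:R * (x ^+ n * cayley x ^+ m.-1 * cayley_jac x)).
Proof.
move=> /(is_derive_cayley R) dc.
have -> : (fun y => y ^+ n * cayley y ^+ m) = id ^+ n * @cayley R ^+ m.
  by apply/funext => y; rewrite !fctE.
apply: is_derive_eq; rewrite /GRing.scale/= !fctE.
by ring.
Qed.

Lemma continuous_monomial (R : realType) (n m : nat) (x : R) : 1 + x != 0 ->
  {for x, continuous (fun y : R => y ^+ n * cayley y ^+ m)}.
Proof.
by move=> /(is_derive_monomial R n m); exact: is_derive1_continuous.
Qed.

Lemma continuous_cayley_jac (R : realType) (x : R) : 1 + x != 0 ->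
  {for x, continuous (@cayley_jac R)}.
Proof.
move=> x0; apply: cvgM; first exact: cvg_cst.
apply: cvgV; first by rewrite expf_neq0.
by apply: cvgM; (apply: cvgD; [exact: cvg_cst|exact: cvg_id]).
Qed.

Lemma continuous_jac_monomial (R : realType) (n m : nat) (x : R) : 1 + x != 0 ->
  {for x, continuous (fun y : R => y ^+ n * cayley y ^+ m * cayley_jac y)}.
Proof.
move=> x0; apply: cvgM; first exact: continuous_monomial.
exact: continuous_cayley_jac.
Qed.

(** The two integral forms of the connector without their prefactors: [moment] integrates against
    [dx], [jac_moment] against [-du], pulled back to [x]. *)
Definition moment (R : realType) (n m : nat) : R :=
  \int[mu]_(x in I01 R) (x ^+ n * cayley x ^+ m).
Definition jac_moment (R : realType) (n m : nat) : R :=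
  \int[mu]_(x in I01 R) (x ^+ n * cayley x ^+ m * cayley_jac x).

Lemma integrable_monomial (R : realType) (n m : nat) :
  mu.-integrable (I01 R) (EFin \o (fun y : R => y ^+ n * cayley y ^+ m)).
Proof.
by apply: continuous01_integrable => x /itv01_neq0; exact: continuous_monomial.
Qed.

Lemma integrable_jac_monomial (R : realType) (n m : nat) :
  mu.-integrable (I01 R)
    (EFin \o (fun y : R => y ^+ n * cayley y ^+ m * cayley_jac y)).
Proof.
apply: continuous01_integrable => x /itv01_neq0.
exact: continuous_jac_monomial.
Qed.

(** Integrate the derivative of [x ^+ n * u ^+ m] with [u = cayley x]. Since [u] is 0 at [x = 1] and
    1 at [x = 0], the boundary values are [0 ^+ m] and [0 ^+ n]. When an exponent is 0, its
    coefficient kills the term with the truncated predecessor. *)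
Lemma moment_by_parts (R : realType) (n m : nat) :
  n%:R * moment R n.-1 m - m%:R * jac_moment R n m.-1
  = (m == 0)%:R - (n == 0)%:R.
Proof.
rewrite -!RintegralZl//; [|exact: integrable_jac_monomial
                         |exact: integrable_monomial].
rewrite -RintegralB//; last 2 first.
- by apply: continuous01_integrable => x /itv01_neq0 x0; apply: cvgM;
    [exact: cvg_cst|exact: continuous_monomial].
- by apply: continuous01_integrable => x /itv01_neq0 x0; apply: cvgM;
    [exact: cvg_cst|exact: continuous_jac_monomial].
apply: etrans.
  apply: (Rintegral01_FTC R (fun y => y ^+ n * cayley y ^+ m)) => x.
    move=> /itv01_neq0 x0; apply: cvgB; apply: cvgM; try exact: cvg_cst.
      exact: continuous_monomial.
    exact: continuous_jac_monomial.
  by move=> /itv01_neq0 x0; exact: is_derive_monomial.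
by rewrite /cayley subrr mul0r subr0 addr0 divr1 !expr1n !expr0n mul1r mulr1.
Qed.

Lemma moment_ge0 (R : realType) (n m : nat) : 0 <= moment R n m.
Proof.
apply: Rintegral_ge0 => x x01; rewrite mulr_ge0// exprn_ge0 ?cayley_ge0//.
by move: x01; rewrite /= in_itv/= => /andP[].
Qed.

(* With [u = cayley x] and [j = cayley_jac x = - du/dx], the two recursions
   integrate [(1 - x ^ 2) j = 2 u] and [1 - u ^ 2 = 2 x j]. *)
Lemma jac_moment_rec (R : realType) (n m : nat) :
  jac_moment R n m - jac_moment R n.+2 m = 2 * moment R n m.+1.
Proof.
rewrite -RintegralZl//; last exact: integrable_monomial.
rewrite -RintegralB//; try exact: integrable_jac_monomial.
apply: eq_Rintegral => x; rewrite inE => /itv01_neq0 x0.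
rewrite !exprS; move: (x ^+ n) (cayley x ^+ m) => a b.
by rewrite /cayley_jac /cayley; field.
Qed.

Lemma moment_rec (R : realType) (n m : nat) :
  moment R n m - moment R n m.+2 = 2 * jac_moment R n.+1 m.
Proof.
rewrite -RintegralZl//; last exact: integrable_jac_monomial.
rewrite -RintegralB//; try exact: integrable_monomial.
apply: eq_Rintegral => x; rewrite inE => /itv01_neq0 x0.
rewrite !exprS; move: (x ^+ n) (cayley x ^+ m) => a b.
by rewrite /cayley_jac /cayley; field.
Qed.

(** On the unit interval [x ^+ n <= 1], and the Jacobian is at least 1/2 because
    [(1 + x) ^+ 2 <= 4]. *)
Lemma moment_le (R : realType) (n m : nat) :
  moment R n m <= 2 * jac_moment R 0 m.
Proof.
rewrite -RintegralZl//; last exact: integrable_jac_monomial.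
apply: le_Rintegral => //; first exact: integrable_monomial.
  by apply: continuous01_integrable => x /itv01_neq0 x0; apply: cvgM;
    [exact: cvg_cst|exact: continuous_jac_monomial].
move=> x x01; move: (x01); rewrite /= in_itv/= => /andP[x0 x1].
rewrite expr0 mul1r mulrCA mulrC ler_wpM2l ?exprn_ge0 ?cayley_ge0//.
rewrite (@le_trans _ _ 1) ?exprn_ile1//.
by rewrite /cayley_jac mulrA ler_pdivlMr ?exprn_gt0 ?ltr_pwDl//; nra.
Qed.

(** Here [u ^+ m <= 1], and the Jacobian is at most 2. *)
Lemma jac_moment_le (R : realType) (n m : nat) :
  jac_moment R n m <= 2 * moment R n 0.
Proof.
rewrite -RintegralZl//; last exact: integrable_monomial.
apply: le_Rintegral => //; first exact: integrable_jac_monomial.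
  by apply: continuous01_integrable => x /itv01_neq0 x0; apply: cvgM;
    [exact: cvg_cst|exact: continuous_monomial].
move=> x x01; move: (x01); rewrite /= in_itv/= => /andP[x0 x1].
rewrite expr0 mulr1 -mulrA mulrC ler_wpM2r ?exprn_ge0//.
rewrite -[leRHS]mul1r ler_pM ?exprn_ge0 ?cayley_ge0 ?cayley_jac_ge0//.
  by rewrite exprn_ile1 ?cayley_ge0 ?cayley_le1.
by rewrite /cayley_jac ler_pdivrMr ?exprn_gt0 ?ltr_pwDl//; nra.
Qed.

(** * The connector, its recursions and its decay *)

(** Only [n = 0] needs a convention; the value 1 at [m = 0] comes out of the integral. *)
Definition connector (R : realType) (n m : nat) : R :=
  if n is n'.+1 then n%:R * moment R n' m else 1.

Arguments connector : simpl never.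

Lemma connectorn0 (R : realType) (n : nat) : connector R n 0 = 1.
Proof.
case: n => // n; have := moment_by_parts R n.+1 0.
by rewrite mul0r !subr0.
Qed.

(** Integration by parts: the boundary term vanishes for [n > 0], and for [n = 0] it supplies the
    conventional value 1. *)
Lemma connectorE (R : realType) (n m : nat) :
  connector R n m.+1 = m.+1%:R * jac_moment R n m.
Proof.
case: n => [|n]; last first.
  rewrite /connector.
  by have /eqP := moment_by_parts R n.+1 m.+1; rewrite subrr subr_eq0 => /eqP.
have := moment_by_parts R 0 m.+1; rewrite mul0r !sub0r => /oppr_inj.
by move=> /esym.
Qed.

Lemma connector_ge0 (R : realType) (n m : nat) : 0 <= connector R n m.
Proof. by case: n => // n; rewrite mulr_ge0// moment_ge0. Qed.

Lemma connector_recl (R : realType) (n m : nat) :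
  connector R n m - connector R n.+2 m
  = 2 * m%:R * (connector R n.+1 m / n.+1%:R).
Proof.
case: m => [|m]; first by rewrite !connectorn0 subrr mulr0 mul0r.
rewrite !connectorE -mulrBr jac_moment_rec -connectorE /connector.
have n0 : n.+1%:R != 0 :> R by [].
by field.
Qed.

Lemma connector_recr (R : realType) (n m : nat) :
  connector R n m - connector R n m.+2
  = 2 * n%:R * (connector R n m.+1 / m.+1%:R).
Proof.
case: n => [|n]; first by rewrite subrr mulr0 mul0r.
rewrite [in RHS]connectorE /connector -mulrBr moment_rec.
have m0 : m.+1%:R != 0 :> R by [].
by field.
Qed.

(** With the second index positive and fixed, the connector is O(1/n), since [moment R n 0] equals
    [1 / n.+1]. This makes the telescoping sums in [n] converge to their first term. *)
Lemma connector_lel (R : realType) (n m : nat) :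
  connector R n m.+1 <= 2 * m.+1%:R / n.+1%:R.
Proof.
rewrite connectorE mulrAC [leRHS]mulrC ler_wpM2l//.
apply: le_trans (jac_moment_le R n m) _; rewrite ler_wpM2l//.
have := connectorn0 R n.+1; rewrite /connector => /(canRL (mulKf _)) ->//.
by rewrite mulr1.
Qed.

Lemma connector_ler (R : realType) (n m : nat) :
  connector R n.+1 m <= 2 * n.+1%:R / m.+1%:R.
Proof.
rewrite /connector mulrAC [leRHS]mulrC ler_wpM2l//.
apply: le_trans (moment_le R n m) _; rewrite ler_wpM2l//.
have := connectorE R 0 m; rewrite /connector => /esym/(canRL (mulKf _)) ->//.
by rewrite mulr1.
Qed.

Local Open Scope ereal_scope.

(** * Telescoping sums of connectors *)

Lemma cvg0_harmonic_bound {R : realType} (c : R) (f : nat -> R) :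
  (forall j, 0 <= f j <= c / j.+1%:R)%R -> f @ \oo --> (0 : R)%R.
Proof.
move=> fc; apply: (@squeeze_cvgr _ _ _ _ (fun=> 0%R) (c \*o harmonic)).
- by apply: nearW => j; exact: fc.
- exact: cvg_cst.
- by rewrite -[X in _ --> X](mulr0 c); apply: cvgMr; exact: cvg_harmonic.
Qed.

Lemma esum_telescope {R : realType} (f : nat -> R) :
    (forall j, f j.+1 <= f j)%R -> f @ \oo --> (0 : R)%R ->
  \esum_(j in setT) (f j - f j.+1)%:E = (f 0%N)%:E.
Proof.
move=> fS f0; rewrite -nneseries_esumT; last first.
  by move=> j; rewrite lee_fin subr_ge0.
apply: cvg_lim => //.
have -> : (fun n => \sum_(0 <= i < n) (f i - f i.+1)%:E) =
          EFin \o (fun n => f 0%N - f n)%R.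
  apply/funext => n /=; rewrite sumEFin; congr EFin.
  rewrite -[RHS]opprB -(@telescope_sumr _ _ _ f)// -sumrN.
  by apply: eq_bigr => i _; rewrite opprB.
apply: cvg_EFin; first exact: nearW.
by rewrite -[X in _ --> X]subr0; apply: cvgB => //; exact: cvg_cst.
Qed.

Lemma exchange_esum {R : realType} {T1 T2 : choiceType} (I : set T1)
    (J : set T2) (a : T1 -> T2 -> \bar R) :
    (forall i j, I i -> J j -> 0 <= a i j) ->
  \esum_(i in I) \esum_(j in J) a i j = \esum_(j in J) \esum_(i in I) a i j.
Proof.
move=> a0; rewrite esum_esum// esum_esum; last by move=> j i ? ?; exact: a0.
apply: (reindex_esum _ _ (fun p : T2 * T1 => (p.2, p.1))); split => //=.
- by move=> [j i] [].
- by move=> [j1 i1] [j2 i2] _ _ [-> ->].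
- by move=> [i j] [Ii Jj]; exists (j, i).
Qed.

(** The indices [n + j.*2.+1] are exactly the integers above [n] of the opposite parity. The second
    argument is a successor so that the connector decays and [2 * m.+1] can be divided by. *)
Lemma esum_connectorl {R : realType} (c : R) (n m : nat) : (0 <= c)%R ->
  \esum_(j in setT)
     (c * (connector R (n + j.*2.+1) m.+1 / (n + j.*2.+1)%:R))%:E
  = (c * connector R n m.+1 / (2 * m.+1%:R))%:E.
Proof.
move=> c0.
have cS j := connector_recl R (n + j.*2) m.+1.
pose f j := (c * connector R (n + j.*2) m.+1 / (2 * m.+1%:R))%R.
have fE j : (f j - f j.+1 =
             c * (connector R (n + j.*2.+1) m.+1 / (n + j.*2.+1)%:R))%R.
  rewrite /f doubleS !addnS -mulrBl -mulrBr cS.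
  have m0 : m.+1%:R != 0%R :> R by [].
  have n0 : (n + j.*2).+1%:R != 0%R :> R by [].
  move: m0 n0; move: (m.+1%:R : R)%R ((n + j.*2).+1%:R : R)%R => x y x0 y0.
  by field; rewrite x0 y0.
transitivity (f 0%N)%:E; last by rewrite /f addn0.
rewrite -esum_telescope.
- by apply: eq_esum => j _; rewrite fE.
- by move=> j; rewrite -subr_ge0 fE mulr_ge0// divr_ge0// connector_ge0.
(* By [connector_lel] the numerator is at most [c] times [2 * m.+1 / (n + j.*2).+1], and
   [j <= n + j.*2]. *)
- apply: (cvg0_harmonic_bound c) => j; rewrite /f.
  rewrite divr_ge0 ?mulr_ge0 ?connector_ge0//= -mulrA ler_wpM2l//.
  rewrite ler_pdivrMr ?mulr_gt0// mulrC.
  apply: le_trans (connector_lel R _ _) _; rewrite ler_wpM2l ?mulr_ge0//.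
  by rewrite lef_pV2 ?posrE// ler_nat ltnS -addnn addnA leq_addl.
Qed.

(** Telescoping along even second indices: each difference produces the odd index in between, and
    the first term is known from [connectorn0]. *)
Lemma esum_connectorr {R : realType} (c : R) (n : nat) : (0 <= c)%R ->
  \esum_(j in setT)
     (c * (connector R n.+1 j.*2.+1 * (2 / j.*2.+1%:R)))%:E = (c / n.+1%:R)%:E.
Proof.
move=> c0.
pose f j := (c * connector R n.+1 j.*2 / n.+1%:R)%R.
have fE j : (f j - f j.+1 =
             c * (connector R n.+1 j.*2.+1 * (2 / j.*2.+1%:R)))%R.
  rewrite /f doubleS -mulrBl -mulrBr connector_recr.
  have m0 : j.*2.+1%:R != 0%R :> R by [].
  have n0 : n.+1%:R != 0%R :> R by [].
  move: m0 n0; move: (j.*2.+1%:R : R)%R (n.+1%:R : R)%R => x y x0 y0.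
  by field; rewrite x0 y0.
transitivity (f 0%N)%:E; last by rewrite /f connectorn0 mulr1.
rewrite -esum_telescope.
- by apply: eq_esum => j _; rewrite fE.
- move=> j; rewrite -subr_ge0 fE; apply: mulr_ge0 => //.
  by apply: mulr_ge0; [exact: connector_ge0|exact: divr_ge0].
- apply: (cvg0_harmonic_bound (2 * c)%R) => j; rewrite /f.
  rewrite divr_ge0//=; last by apply: mulr_ge0 => //; exact: connector_ge0.
  rewrite [X in (_ <= X / _)%R]mulrC -[leLHS]mulrA -[leRHS]mulrA ler_wpM2l//.
  rewrite ler_pdivrMr// mulrAC.
  apply: le_trans (connector_ler R _ _) _; rewrite ler_wpM2l ?mulr_ge0//.
  by rewrite lef_pV2 ?posrE// ler_nat ltnS -addnn leq_addl.
Qed.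

(** * Peeling the largest entry off a mixed index *)

(** For the empty tuple the default head 0 has the right parity too, so it serves as a fictitious
    entry [n_0 = 0]. *)
Lemma odd_head_mixed (k : nat) (t : k.-tuple nat) :
  (forall p : 'I_k, tnth t p = k - p %[mod 2]) -> odd (head 0%N t) = odd k.
Proof.
case: k t => [|k] t tk; first by rewrite tuple0.
have := tk ord0; rewrite (tnth_nth 0%N) nth0 /= subn0 !modn2.
by move=> /(congr1 odd); rewrite !oddb.
Qed.

(** Consecutive entries have opposite parity, so the new largest entry exceeds the old one by an odd
    number [j.*2.+1]. The default head 0 covers [k = 0], where the single entry is any odd positive
    integer. *)
Lemma esum_mixed_indexS {R : realType} (k : nat)
    (a : k.+1.-tuple nat -> \bar R) :
    (forall n, 0 <= a n) ->
  \esum_(n in @mixed_index k.+1) a n =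
  \esum_(t in @mixed_index k) \esum_(j in setT)
     a [tuple of (head 0%N t + j.*2.+1)%N :: t].
Proof.
move=> a0; rewrite esum_esum//.
apply: (reindex_esum _ _ (fun p : k.-tuple nat * nat =>
  [tuple of (head 0%N p.1 + p.2.*2.+1)%N :: p.1])); split.
- move=> [t j] [/= [st pt tk] _].
  split => /=.
  + case: (tval t) st => //= b s ->.
    by rewrite andbT /gtn/= addnS ltnS leq_addr.
  + by rewrite pt addnS.
  (* Consing shifts positions and length together, so the parity conditions on the tail are
     unchanged; only the new head has to be checked. *)
  + move=> p; case: (unliftP ord0 p) => [q|] ->.
      by rewrite tnthS tk.
    rewrite tnth0 /= subn0 !modn2 oddD (odd_head_mixed _ _ tk) /= odd_double.
    by case: (odd k).
- move=> [t1 j1] [t2 j2] _ _ /= [].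
  move=> + /val_inj t12; rewrite t12 => /eqP; rewrite eqn_add2l => /eqP [].
  by move=> /double_inj ->.
- move=> n [sn pn nk].
  pose b := thead n; pose t := [tuple of behead n].
  have nE : n = [tuple of b :: t] by exact: tuple_eta.
  have tk (p : 'I_k) : tnth t p = k - p %[mod 2].
    by have := nk (lift ord0 p); rewrite nE tnthS.
  have ob : odd b = ~~ odd (head 0%N t).
    by have /= := odd_head_mixed _ _ nk; rewrite (odd_head_mixed _ _ tk) nE.
  move: sn pn; rewrite nE /= => sn /andP[b0 pt].
  have tb : (head 0%N t < b)%N.
    by move: sn; rewrite /t/=; case: (behead n) => //= c s /andP[].
  (* The halving is exact because the gap [b - head 0 t] is odd. *)
  exists (t, (b - head 0%N t).-1./2).
    by do 2 split => //; exact: path_sorted sn.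
  apply: val_inj => /=; congr cons.
  have := odd_double_half (b - head 0%N t).-1.
  have -> : odd (b - head 0%N t).-1 = false.
    by rewrite -subnS oddB//= ob; case: odd.
  by rewrite add0n => ->; rewrite prednK ?subn_gt0// subnKC// ltnW.
Qed.

(** Induction on [k] with [c] general: summing out the largest entry by [esum_connectorl] moves the
    connector to the next entry and turns [c] into [c / (2 * m.+1)]. At the end only the empty tuple
    is left, where the connector at 0 is 1. *)
Lemma esum_mixed_connector {R : realType} (k m : nat) (c : R) : (0 <= c)%R ->
  \esum_(t in @mixed_index k)
     (c * \prod_(p < k) (tnth t p)%:R^-1 * connector R (head 0%N t) m.+1)%:E
  = (c / (2 * m.+1%:R) ^+ k)%:E.
Proof.
elim: k c => [|k IHk] c c0.
  have -> : @mixed_index 0 = [set [tuple]].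
    apply/seteqP; split => t /=; first by rewrite tuple0.
    by move=> ->; split => // -[].
  by rewrite esum_set1/= ?big_ord0 ?mulr1 ?lee_fin// expr0 divr1.
rewrite esum_mixed_indexS; last first.
  move=> n; rewrite lee_fin mulr_ge0 ?connector_ge0// mulr_ge0//.
  by apply: prodr_ge0.
rewrite exprS invfM mulrA -IHk; last by rewrite divr_ge0// mulr_ge0.
apply: eq_esum => t _.
pose w : R := (\prod_(p < k) (tnth t p)%:R^-1)%R.
have w0 : (0 <= w)%R by apply: prodr_ge0.
rewrite (_ : (c / _ * _ * _)%R =
  (c * w * connector R (head 0%N t) m.+1 / (2 * m.+1%:R))%R); last first.
  by rewrite -!mulrA; congr (_ * _)%R; rewrite mulrC mulrA.
rewrite -esum_connectorl ?mulr_ge0//.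
apply: eq_esum => j _; congr EFin.
rewrite big_ord_recl tnth0/=.
under eq_bigr do rewrite tnthS.
by rewrite -/w; move: (connector _ _ _) (_^-1)%R => x y; ring.
Qed.

(** * Zeta values as unordered sums *)

Lemma is_cvg_zeta {R : realType} (s : nat) : (2 <= s)%N ->
  cvgn (series (fun n : nat => (n.+1%:R ^+ s)^-1%R : R)).
Proof.
move=> s2; apply: nondecreasing_is_cvgn.
  by apply/nondecreasing_seqP => n; rewrite seriesSr lerDl invr_ge0 exprn_ge0.
exists 2%R => _ [n _ <-].
(* This bound grows by [2 / (n.+1 * n.+2)] at each step, which dominates [1 / n.+1 ^+ 2] because
   [n.+2 <= 2 * n.+1]. *)
suff : (series (fun n => (n.+1%:R ^+ s)^-1 : R) n <= 2 - 2 / n.+1%:R)%R.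
  by move=> /le_trans; apply; rewrite gerBl divr_ge0.
elim: n => [|n IHn]; first by rewrite /series/= big_geq// divr1 subrr.
rewrite seriesSr.
apply: le_trans (lerD IHn (_ : _ <= 2 / (n.+1%:R * n.+2%:R))%R) _.
  apply: (@le_trans _ _ (n.+1%:R ^+ 2)^-1%R).
    by rewrite lef_pV2 ?posrE ?exprn_gt0// ler_weXn2l// ler1n.
  rewrite -[leLHS]mul1r ler_pdivrMr ?exprn_gt0// mulrAC ler_pdivlMr ?mulr_gt0//.
  rewrite mul1r expr2 mulrA [leLHS]mulrC ler_wpM2r//.
  by rewrite -natrM ler_nat mul2n -addnn addnS ltnS leq_addr.
rewrite -[n.+2]addn1 natrD.
have : (0 < n.+1%:R :> R)%R by [].
move: (n.+1%:R : R)%R => x x0.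
have -> // : (2 - 2 / x + 2 / (x * (x + 1)) = 2 - 2 / (x + 1) :> R)%R.
by field; rewrite !gt_eqF// addr_gt0.
Qed.

Lemma esum_zeta {R : realType} (s : nat) : (2 <= s)%N ->
  \esum_(n in setT) ((n.+1%:R ^+ s)^-1)%:E = (zeta R s)%:E.
Proof.
move=> s2; rewrite -nneseries_esumT; last by move=> n; rewrite lee_fin.
rewrite /zeta -EFin_lim; last exact: is_cvg_zeta.
by congr (limn _); apply/funext => n; rewrite /= -sumEFin.
Qed.

Lemma esum_odd_zeta {R : realType} (s : nat) : (2 <= s)%N ->
  \esum_(j in setT) ((j.*2.+1%:R ^+ s)^-1)%:E
  = ((1 - (2 ^+ s)^-1) * zeta R s)%:E.
Proof.
move=> s2.
suff : \esum_(j in setT) ((j.*2.+1%:R ^+ s)^-1)%:E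
       + ((2 ^+ s)^-1 * zeta R s)%:E = (zeta R s)%:E.
  move=> /(congr1 (fun z => z - ((2 ^+ s)^-1 * zeta R s)%:E)).
  by rewrite addeK// -EFinB mulrBl mul1r.
(* The index [n] stands for the denominator [n.+1]: even [n] give the odd denominators, and odd [n]
   give [2 * j.+1], hence the factor [2 ^- s]. *)
rewrite -[RHS]esum_zeta// [RHS](esumID [set n | ~~ odd n])//.
rewrite !setTI; congr (_ + _).
  rewrite [RHS](reindex_esum setT _ double)//.
  split => //= [j _|i j _ _ /double_inj//|n /= /negbTE n2].
    by rewrite /= odd_double.
  by exists n./2 => //; rewrite -[RHS]odd_double_half n2.
rewrite [RHS](reindex_esum setT _ (fun j => j.*2.+1)); last first.
  split => /= [j _|i j _ _ [/double_inj]//|n /= /negP].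
    by rewrite /= odd_double.
  rewrite negbK => n2; exists n./2 => //.
  by rewrite -[RHS]odd_double_half n2.
rewrite EFinM -esum_zeta// -nneseries_esumT; last by move=> n; rewrite lee_fin.
rewrite -nneseries_esumT; last by move=> n; rewrite lee_fin.
rewrite -nneseriesZl; last by move=> n _; rewrite lee_fin.
apply: eq_eseriesr => n _; rewrite -EFinM -invfM -exprMn -natrM.
by rewrite mul2n doubleS.
Qed.

(** * Assembly of the evaluation *)

(** The leading exponent 2 leaves one spare reciprocal of the largest entry, the factor that is
    expanded into connectors. *)
Lemma prod_mixed_weight {R : realType} (k : nat) (n : k.+1.-tuple nat) :
  ((\prod_(p < k.+1) (tnth n p)%:R ^+ nth 0%N (2%N :: nseq k 1%N) p)^-1 =
   \prod_(p < k.+1) (tnth n p)%:R^-1 / (head 0%N n)%:R :> R)%R.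
Proof.
have nE : tnth n ord0 = head 0%N n by rewrite (tnth_nth 0%N) nth0.
rewrite big_ord_recl [in RHS]big_ord_recl nE /=.
rewrite (eq_bigr (fun p : 'I_k => (tnth n (lift ord0 p))%:R)%R); last first.
  by move=> p _; rewrite nth_nseq ltn_ord.
by rewrite expr2 !invfM prodfV mulrAC.
Qed.

Lemma mixed_value_21 {R : realType} (k : nat) :
  mixed_value R (2%N :: nseq k 1%N) =
  \esum_(n in @mixed_index k.+1)
    ((\prod_(p < k.+1) (tnth n p)%:R ^+ nth 0%N (2%N :: nseq k 1%N) p)^-1)%:E.
Proof. by rewrite /mixed_value /= size_nseq. Qed.

Theorem theorem4p3 (R : realType) (N : nat) (hN : (1 <= N)%N) :
  mixed_value R (2%N :: nseq N.-1 1%N) =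
  ((2 ^+ N.+1 - 1) / 2 ^+ (2 * N) * zeta R N.+1)%:E.
Proof.
case: N hN => // k _; rewrite mixed_value_21.
pose w n : R := (\prod_(p < k.+1) (tnth n p)%:R^-1)%R.
have w0 n : (0 <= w n)%R by apply: prodr_ge0.
transitivity (\esum_(n in @mixed_index k.+1) \esum_(j in setT)
    (w n * (connector R (head 0%N n) j.*2.+1 * (2 / j.*2.+1%:R)))%:E).
  apply: eq_esum => n [_ n0 _]; rewrite prod_mixed_weight.
  (* The expansion of [1 / n_N] holds for positive entries only. *)
  have : (0 < head 0 n)%N by rewrite (tuple_eta n) /= in n0 *; case/andP: n0.
  by case: (head 0%N n) => // h _; rewrite esum_connectorr.
rewrite exchange_esum; last first.
  move=> n j _ _; rewrite lee_fin mulr_ge0// mulr_ge0 ?connector_ge0//.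
(* With [m = j.*2.+1], the sum over mixed indices is [2 / m * (2 * m) ^- k.+1], that is
   [2 ^- k * m ^- k.+2]. *)
transitivity (\esum_(j in setT)
    ((2 ^+ k)^-1%:E * ((j.*2.+1%:R : R) ^+ k.+2)^-1%:E)).
  apply: eq_esum => j _; transitivity (\esum_(n in @mixed_index k.+1)
      (2 / j.*2.+1%:R * w n * connector R (head 0%N n) j.*2.+1)%:E).
    by apply: eq_esum => n _; congr EFin; ring.
  rewrite esum_mixed_connector// -EFinM; congr EFin.
  have : (j.*2.+1%:R : R) != 0%R by [].
  move: (j.*2.+1%:R : R)%R => x x0.
  have := expf_neq0 k x0; have : (2 ^+ k != 0 :> R)%R by rewrite expf_neq0.
  rewrite exprMn !exprS; move: (x ^+ k)%R (2 ^+ k : R)%R => y z z0 y0.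
  by field; rewrite x0 y0 z0.
rewrite -nneseries_esumT; last by move=> j; rewrite mule_ge0 ?lee_fin.
rewrite nneseriesZl; last by move=> n _; rewrite lee_fin.
rewrite nneseries_esumT; last by move=> n; rewrite lee_fin.
(* It remains to see that [2 ^- k * (1 - 2 ^- k.+2)] equals [(2 ^+ k.+2 - 1) / 2 ^+ (2 * k.+1)]. *)
rewrite esum_odd_zeta// -EFinM; congr EFin.
have : (2 ^+ k != 0 :> R)%R by rewrite expf_neq0.
rewrite mulnS mul2n -addnn !exprS exprD; move: (2 ^+ k : R)%R => z z0.
by field.
Qed.
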